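(* Let $X$ be a (real) Banach space and let $A\subset X$ be a non-empty, closed, convex and bounded set. Let $f:X\to\mathbb{R}\cup\{+\infty\}$ be a proper lower semicontinuous function and let $a\in\mathrm{dom}\, f$. If $$f(a)\le\inf f(A),$$ then there exists $\bar x\in[a,A]$ such that $f(\bar x)\le f(a)$ and $$f^-(\bar x;A-a)\ge 0.$$
   Context: $\mathrm{dom}\, f=\{x\in X: f(x)<+\infty\}$; $f$ is proper if $\mathrm{dom}\, f\neq\varnothing$. For a non-empty set $A\subset X$, $\inf f(A):=\inf_{x\in A}f(x)$ and $A-a:=\{x-a: x\in A\}$. The multidirectional interval between a point $a$ and a non-empty set $A$ is $[a,A]:=\{a+t(x-a): t\in[0,1],\ x\in A\}$. For a non-empty set $D\subset X$ and $x\in\mathrm{dom}\, f$, the $D$-directional derivative of $f$ at $x$ is $$f^-(x;D):=\liminf_{t\downarrow 0}\frac{\inf f(x+tD)-f(x)}{t}\in[-\infty,+\infty],$$ where $x+tD=\{x+td: d\in D\}$. *)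

(* Defs.v *)
From HB Require Import structures.
From mathcomp Require Export all_boot all_order all_algebra.
From mathcomp Require Export all_classical all_reals all_analysis.
Export numFieldNormedType.Exports.
Import Order.TTheory GRing.Theory Num.Theory.

Set Implicit Arguments.
Unset Strict Implicit.
Unset Printing Implicit Defensive.

Local Open Scope classical_set_scope.
Local Open Scope ring_scope.

Section Definitions.
Context {R : realType} {X : normedModType R}.
Implicit Types (f : X -> \bar R) (A D : set X) (a x : X).

Definition dom f : set X := [set x | (f x < +oo)%E].

Definition proper_fun f : Prop := dom f !=set0.

Definition inf_on f A : \bar R := ereal_inf (f @` A).

Definition set_sub A a : set X := [set x - a | x in A].

Definition point_plus x (t : R) D : set X := [set x + t *: d | d in D].

Definition multi_interval a A : set X :=
  [set y | exists (t : R) x, [/\ 0 <= t <= 1, A x & y = a + t *: (x - a)]].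

(* Meant for x in dom f and f never -oo: f x is then finite, so the extended
   difference below is never an ill-defined oo - oo. *)
Definition dir_deriv f x D : \bar R :=
  limf_einf (fun t : R => (inf_on f (point_plus x t D) - f x) * (t^-1)%:E)%E
    0^'+.

End Definitions.

(* Main.v *)
(** A point x is moved along the directions of A - a without increasing f, the
    elapsed time s being recorded: by convexity of A, being at x at time s
    entails x in a + s (A - a). As A is bounded, the position is Lipschitz in
    time, so completeness and lower semicontinuity of f give chains upper
    bounds, and by Zorn's lemma there are maximal points among those of time at
    most 1. A maximal point of time s < 1 has f >= f(x) on x + t (A - a) for all
    small t > 0, hence a nonnegative derivative. If f takes a value below f(a)
    on [a, A], descending from there cannot reach time 1, where x lies in A and
    f(x) >= f(a). Otherwise a itself minimizes f on [a, A]. *)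
Require Import Defs.
From mathcomp Require Import ring lra.
Import Order.TTheory GRing.Theory Num.Theory numFieldNormedType.Exports.
Set Implicit Arguments.
Unset Strict Implicit.
Unset Printing Implicit Defensive.

Local Open Scope classical_set_scope.
Local Open Scope ring_scope.

(** The convex combination of [x] and [y] with weights [u / (u + v)] and [v / (u + v)] serves as
    [z]. This lets two successive moves be merged into one. *)
Lemma convex_set_cone (R : realFieldType) (X : lmodType R) (A : set X)
    (a x y : X) (u v : R) :
  convex_set A -> A x -> A y -> 0 <= u -> 0 <= v ->
  exists2 z, A z & u *: (x - a) + v *: (y - a) = (u + v) *: (z - a).
Proof.
move=> cA Ax Ay u0 v0.
have [uv0|uvn0] := eqVneq (u + v) 0.
  have -> : u = 0 by lra.
  have -> : v = 0 by lra.
  by exists x => //; rewrite addr0 !scale0r addr0.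
have uv_gt0 : 0 < u + v by rewrite lt_def uvn0 addr_ge0.
have l01 : 0 <= u / (u + v) <= 1.
  by rewrite divr_ge0 ?addr_ge0//= ler_pdivrMr// mul1r lerDl.
pose l : {i01 R} := Itv01 (proj1 (andP l01)) (proj2 (andP l01)).
exists (conv l (x : convex_lmodType X) y).
  by apply/set_mem/cA; rewrite inE.
rewrite /conv/= /unstable.onem.
have -> : u / (u + v) *: x + (1 - u / (u + v)) *: y - a =
    (u + v)^-1 *: (u *: (x - a) + v *: (y - a)).
  rewrite !scalerDr !scalerA !scalerN.
  have -> : 1 - u / (u + v) = v / (u + v) by field.
  rewrite addrACA -opprD -!scalerDl ![(u + v)^-1 * _]mulrC -mulrDl divff//.
  by rewrite scale1r.
by rewrite scalerA divff// scale1r.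
Qed.

(** The lower limit is a supremum of infima over neighbourhoods; the right neighbourhood $]0,
    \delta]$ already yields a nonnegative infimum. *)
Lemma dir_deriv_ge0 (R : realType) (X : normedModType R) (f : X -> \bar R)
    (D : set X) (x : X) (delta : R) :
  f x \is a fin_num -> 0 < delta ->
  (forall (t : R) d, 0 < t <= delta -> D d -> (f x <= f (x + t *: d)%R)%E) ->
  (0 <= dir_deriv f x D)%E.
Proof.
move=> fx delta0 fxD; rewrite /dir_deriv limf_einfE.
apply: le_ereal_sup_tmp.
exists (ereal_inf [set ((inf_on f (point_plus x t D) - f x) * (t^-1)%:E)%E
    | t in [set t : R | 0 < t <= delta]]); last first.
  apply: le_ereal_inf_tmp => _ [t /= t0d <-].
  have /andP[t0 _] := t0d.
  rewrite mule_ge0 ?lee_fin ?invr_ge0 ?(ltW t0)//.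
  rewrite sube_ge0 ?fx//.
  by apply: le_ereal_inf_tmp => _ [_ [d Dd <-] <-]; exact: fxD.
exists [set t : R | 0 < t <= delta] => //=.
near=> t; apply/andP; split=> //.
by near: t; exact: nbhs_right_le.
Unshelve. all: by end_near. Qed.

Lemma lower_semicontinuous_cvg_le (R : realFieldType) (X : topologicalType)
    (f : X -> \bar R) (T : Type) (F : set_system T) {FF : ProperFilter F}
    (u : T -> X) (x : X) (c : \bar R) :
  lower_semicontinuous f -> (-oo < c)%E -> u @ F --> x ->
  (\forall t \near F, (f (u t) <= c)%E) -> (f x <= c)%E.
Proof.
move=> f_lsc; case: c => [r _ ux uc|_ _ _|//]; last exact: leey.
rewrite leNgt; apply/negP => /f_lsc[V Vx Vr].
have [t [/Vr rt]] := filter_ex (filterI (ux V Vx : F (u @^-1` V)) uc).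
by rewrite leNgt rt.
Qed.

Section Descent.
Context {R : realType} {X : completeNormedModType R}.
Context (A : set X) (f : X -> \bar R) (a : X).

(* The pairs are (time, position). *)
Definition descends (p q : R * X) : Prop :=
  [/\ p.1 <= q.1,
      exists2 z, A z & q.2 = p.2 + (q.1 - p.1) *: (z - a)
    & (f q.2 <= f p.2)%E].

Lemma descends_refl p : A !=set0 -> descends p p.
Proof.
by move=> [z Az]; split=> //; exists z; rewrite // subrr scale0r addr0.
Qed.

Lemma descends_trans q p r : convex_set A ->
  descends p q -> descends q r -> descends p r.
Proof.
move=> cA [pq [x Ax qE] fpq] [qr [y Ay rE] fqr].
split; [exact: le_trans qr|  |exact: le_trans fpq].
have qp0 : 0 <= q.1 - p.1 by rewrite subr_ge0.
have rq0 : 0 <= r.1 - q.1 by rewrite subr_ge0.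
have [z Az zE] := convex_set_cone a cA Ax Ay qp0 rq0.
exists z; first by [].
by rewrite rE qE -addrA zE; congr (_ + _ *: _); ring.
Qed.

Lemma descends_eq p q : descends p q -> q.1 <= p.1 -> q = p.
Proof.
case: p q => [s x] [t y] [/= st [z _ ->] _] ts.
have -> : t = s by apply/le_anti; rewrite ts st.
by rewrite subrr scale0r addr0.
Qed.

Lemma descends_bounded : bounded_set A -> exists2 M, 0 < M &
  forall p q, descends p q -> `|q.2 - p.2| <= M * (q.1 - p.1).
Proof.
(* Only numbers strictly above [N] are known to bound [A], hence the [+ 1]. *)
move=> [N [_ AN]]; pose M := `|N| + 1 + `|a|.
exists M => [|p q [pq [z Az ->] _]].
  by rewrite /M; have := normr_ge0 N; have := normr_ge0 a; lra.
rewrite addrC addKr normrZ ger0_norm ?subr_ge0// mulrC ler_wpM2r ?subr_ge0//.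
rewrite (le_trans (ler_normB _ _))// lerD2r.
apply: AN => //; have := ler_norm N; lra.
Qed.

Hypotheses (A_closed : closed A) (A_convex : convex_set A)
  (A_bounded : bounded_set A).
Hypotheses (f_gt_ninfty : forall x, (-oo < f x)%E).
Hypothesis (f_lsc : lower_semicontinuous f).

(** The bound pairs the supremum of the times with the limit of the positions. *)
Lemma descends_chain_ubound (C : set (R * X)) (b : R) :
  C !=set0 -> total_on C descends -> (forall p, C p -> p.1 <= b) ->
  exists2 q, q.1 <= b & forall p, C p -> descends p q.
Proof.
move=> [p0 Cp0] Ctot Cb.
have [M M0 dM] := descends_bounded A_bounded.
pose tail p := [set q | C q /\ descends p q].
have tail_refl p : C p -> tail p p.
  by move=> Cp; split=> //; case: (Ctot _ _ Cp Cp).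
have tail_sub p q : descends p q -> tail q `<=` tail p.
  by move=> pq r [Cr qr]; split=> //; exact: descends_trans qr.
(* Totality of the chain makes its tails a filter base, along which limits are taken. *)
pose F := filter_from C tail.
have FF : ProperFilter F.
  apply: filter_from_proper => [|p Cp]; last by exists p; exact: tail_refl.
  apply: filter_from_filter; first by exists p0.
  move=> p q Cp Cq; case: (Ctot _ _ Cp Cq) => [pq|qp].
    by exists q => // r qr; split=> //; exact: (tail_sub _ _ pq).
  by exists p => // r pr; split=> //; exact: (tail_sub _ _ qp).
have Ftail p : C p -> F (tail p) by move=> Cp; exists p.
pose S := sup [set p.1 | p in C].
have supC : has_sup [set p.1 | p in C].
  by split; [exists p0.1, p0|exists b => _ [p /Cb pb <-]].
have CS p : C p -> p.1 <= S.
  by move=> Cp; apply: sup_upper_bound => //; exists p.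
have near_sup (e : R) : 0 < e -> exists2 p, C p & S - e < p.1.
  by move=> /sup_adherent/(_ supC)[_ [p Cp <-]]; exists p.
have F1 : fst @ F --> S.
  apply/cvgrPdist_le => e /near_sup[p Cp Sp].
  apply: filterS (Ftail _ Cp) => q [Cq [pq _ _]].
  by rewrite ger0_norm ?subr_ge0 ?CS//; lra.
have F2 : cvg (snd @ F).
  apply/cauchy_cvgP/cauchy_exP => e e0.
  (* Less than [e / M] of time remains after [p], so later positions stay within [e] of [p.2]. *)
  have [p Cp Sp] := near_sup _ (divr_gt0 e0 M0).
  exists p.2; apply: filterS (Ftail _ Cp) => q [Cq pq].
  rewrite -ball_normE/= distrC (le_lt_trans (dM _ _ pq))//.
  rewrite mulrC -ltr_pdivlMr//; have := CS _ Cq; lra.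
set x := lim (snd @ F) in F2.
exists (S, x) => [|p Cp].
  by apply: ge_sup; [exists p0.1, p0|move=> _ [p /Cb pb <-]].
split=> /=; [exact: CS| |]; last first.
  apply: (lower_semicontinuous_cvg_le f_lsc _ F2) => //.
  by apply: filterS (Ftail _ Cp) => q [_ []].
(* If [p] already has time [S], its tail is [p] alone and [x = p.2]. *)
have := CS _ Cp; rewrite le_eqVlt => /predU1P[pS|pS].
  have [_ [z Az _] _] := (tail_refl _ Cp).2.
  exists z => //; rewrite -pS subrr scale0r addr0.
  apply: (cvg_unique _ F2); first exact: norm_hausdorff.
  apply: cvg_near_cst.
  apply: filterS (Ftail _ Cp) => q [Cq pq].
  by rewrite (descends_eq pq)// pS CS.
(* Otherwise this is the limit of the points of [A] that define the moves from [p] to [q], and [A]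
   is closed. *)
exists (a + (S - p.1)^-1 *: (x - p.2)); last first.
  rewrite addrAC subrr add0r scalerA divff ?scale1r ?subr_eq0 ?gt_eqF//.
  by rewrite addrC subrK.
apply: (@closed_cvg _ _ F FF
  (fun q => a + (q.1 - p.1)^-1 *: (q.2 - p.2)) A A_closed).
  (* This [q] has time beyond [p.1], so on its tail the quotient is well defined. *)
  have [q Cq Sq] := near_sup (S - p.1) ltac:(by rewrite subr_gt0).
  near=> r.
  have [Cr [qr _ _]] : tail q r by near: r; exact: Ftail.
  have [_ [_ [z Az zE] _]] : tail p r by near: r; exact: Ftail.
  rewrite zE addrAC subrr add0r scalerA mulVf ?scale1r; last first.
    by rewrite subr_eq0 gt_eqF//; lra.
  by rewrite addrC subrK.
apply: cvgD; first exact: cvg_cst.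
apply: cvgZ; last by apply: cvgB => //; exact: cvg_cst.
apply: cvgV; first by rewrite subr_eq0 gt_eqF.
by apply: cvgB => //; exact: cvg_cst.
Unshelve. all: by end_near. Qed.

(** Zorn's lemma is applied to the points reached from [p] by time [b]; [p] itself bounds the empty
    chain. *)
Lemma descends_maximal (p : R * X) (b : R) : A !=set0 -> p.1 <= b ->
  exists q, [/\ descends p q, q.1 <= b &
    forall r, r.1 <= b -> descends q r -> r = q].
Proof.
move=> A0 pb; pose T := {q | descends p q /\ q.1 <= b}.
pose p_ : T := exist _ p (conj (descends_refl p A0) pb).
pose le (q r : T) := `[< descends (sval q) (sval r) >].
have [|||q qmax] := @ZL_preorder T p_ le.
- by move=> q; apply/asboolP/descends_refl.
- by move=> r q s /asboolP qr /asboolP rs; apply/asboolP/descends_trans/rs.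
- move=> C Ctot; have [C0|/set0P[q0 Cq0]] := eqVneq C set0.
    by exists p_ => q; rewrite C0.
  have [|||q qb ubq] := @descends_chain_ubound (sval @` C) b.
  + by exists (sval q0), q0.
  + move=> _ _ [q Cq <-] [r Cr <-].
    by case: (Ctot _ _ Cq Cr) => /asboolP; [left|right].
  + by move=> _ [q Cq <-]; exact: (svalP q).2.
  have pq : descends p q.
    by apply: (descends_trans A_convex (svalP q0).1); apply: ubq; exists q0.
  exists (exist _ q (conj pq qb)) => r Cr.
  by apply/asboolP/ubq; exists r.
have [pq qb] := svalP q.
exists (sval q); split=> // r rb qr.
have pr : descends p r by exact: descends_trans qr.
(* Preorder maximality only gives a move back from [r] to [q]; no time then elapses, which forces
   equality. *)
have /asboolP[/= rq _ _] := qmax (exist _ r (conj pr rb)) (asboolT qr).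
exact: descends_eq qr rq.
Qed.

End Descent.

Theorem proposition2p2 (R : realType) (X : completeNormedModType R)
    (A : set X) (f : X -> \bar R) (a : X)
    (A_nonempty : A !=set0) (A_closed : closed A) (A_convex : convex_set A)
    (A_bounded : bounded_set A)
    (f_gt_ninfty : forall x, (-oo < f x)%E)
    (f_proper : proper_fun f) (f_lsc : lower_semicontinuous f)
    (a_dom : dom f a)
    (a_le : (f a <= inf_on f A)%E) :
  exists xbar : X,
    [/\ multi_interval a A xbar,
        (f xbar <= f a)%E
      & (0 <= dir_deriv f xbar (set_sub A a))%E].
Proof.
have fin x : (f x <= f a)%E -> f x \is a fin_num.
  by move=> fxa; rewrite fin_numElt f_gt_ninfty (le_lt_trans fxa).
have [[y [[t [x [/andP[t0 t1] Ax yE]]] fya]]|noy] :=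
    pselect (exists y, multi_interval a A y /\ (f y < f a)%E); last first.
  exists a; split=> //.
    by have [z Az] := A_nonempty; exists 0, z; rewrite lexx ler01 scale0r addr0.
  apply: (dir_deriv_ge0 (delta := 1)); rewrite ?fin// => t d /andP[t0 t1].
  move=> [x Ax <-]; rewrite leNgt; apply/negP => fxa.
  apply: noy; exists (a + t *: (x - a)); split=> //.
  by exists t, x; rewrite ltW.
have ay : descends A f a (0, a) (t, y).
  by split=> //=; [exists x; rewrite ?subr0|exact: ltW].
have [[s xbar] [yx /= s1 xmax]] := descends_maximal a A_closed A_convex
  A_bounded f_gt_ninfty f_lsc (p := (t, y)) A_nonempty t1.
have [/= s0 [z Az]] := descends_trans A_convex ay yx.
rewrite subr0 => xE fxa.
have fx_lt : (f xbar < f a)%E by case: yx => _ _ /le_lt_trans; apply.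
(* At time 1, [xbar] would be the point [z] of [A], where [f] is at least [f a]. *)
have {}s1 : s < 1.
  rewrite lt_neqAle s1 andbT; apply/eqP => s1E.
  move: fx_lt; rewrite ltNge (le_trans a_le)//.
  apply: ereal_inf_lbound; exists xbar => //.
  by rewrite xE s1E scale1r addrC subrK.
exists xbar; split=> //; first by exists s, z; rewrite s0 ltW.
(* Steps of length at most [1 - s] keep the time within 1, so a strict decrease of [f] would
   contradict maximality. *)
apply: (dir_deriv_ge0 (delta := 1 - s)); rewrite ?fin ?subr_gt0//.
move=> r d /andP[r0 rs] [w Aw <-]; rewrite leNgt; apply/negP => fxr.
suff: (s + r, xbar + r *: (w - a)) = (s, xbar) by move=> /(congr1 fst)/=; lra.
apply: xmax; first by rewrite /=; lra.
split=> /=; [lra| |exact: ltW].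
by exists w; rewrite // addrAC subrr add0r.
Qed.
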